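(* Let $k$ be a field, $R = k[x,y]$ and $\mathfrak{m} = (x,y)$. Let $I = J_1 \cdots J_r$, where $J_i = \overline{(x^{c_i},y^{d_i})}$ for some positive integers $c_i, d_i$, $i = 1,\dots,r$. Assume that $d_1/c_1 \ge \cdots \ge d_r/c_r$. Let $s = \max\{i \mid d_i/c_i \ge 1\}$, where $s = 0$ if $d_1/c_1 < 1$. For all integers $m,n \ge 0$, $$\ell(R/I^m\mathfrak{m}^n) = \Big(\sum_{i=1}^r \frac{c_id_i}{2} + \sum_{1 \le i < j \le r} c_id_j\Big)m^2 + \frac{n^2}{2} + \Big(\sum_{i=1}^s c_i + \sum_{j=s+1}^r d_j\Big)mn + \frac{1}{2}\sum_{i=1}^r \big(c_i + d_i - \gcd(c_i,d_i)\big)m + \frac{n}{2}.$$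
   Context: $\overline{(x^{c},y^{d})}$ denotes the integral closure of the ideal $(x^c,y^d)$ of $R$. $\ell(\cdot)$ denotes length as an $R$-module; $I^0 = \mathfrak{m}^0 = R$. *)

(* Defs.v *)
From HB Require Import structures.
From mathcomp Require Import all_boot all_order all_algebra.
From mathcomp Require Export mpoly.
From mathcomp.classical Require Import boolp.

Set Implicit Arguments.
Unset Strict Implicit.
Unset Printing Implicit Defensive.

Import GRing.Theory.
Local Open Scope ring_scope.
Local Open Scope quotient_scope.

(* The quotient module V / N: ring_quotient only provides quotients of groups
   and quotients of rings by proper ideals, so the action of R is added here
   to the group quotient. *)
Section QuotientModule.
Variables (R : pzRingType) (V : lmodType R) (N : submodClosed V).

Definition subgroup_of_submod : {pred V} := N.

HB.instance Definition _ := GRing.isZmodClosed.Build V subgroup_of_submod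
  (GRing.submod_closedB (submodClosedP N)).

Definition quot_mod : Type := (Quotient.quot subgroup_of_submod).

HB.instance Definition _ := GRing.Zmodule.on quot_mod.
HB.instance Definition _ :=
  EqQuotient.copy quot_mod (Quotient.quot subgroup_of_submod).

Definition quot_scale (a : R) (q : quot_mod) : quot_mod :=
  \pi_quot_mod (a *: repr q).

Lemma eq_quot_modE (x y : V) :
  (\pi_quot_mod x == \pi_quot_mod y) = (x - y \in N).
Proof. exact: esym (Quotient.idealrBE subgroup_of_submod x y). Qed.

Lemma pi_quot_scale (a : R) (x : V) :
  quot_scale a (\pi_quot_mod x) = \pi_quot_mod (a *: x).
Proof.
apply/eqP; rewrite eq_quot_modE -scalerBr rpredZ //.
by rewrite -eq_quot_modE reprK.
Qed.

Lemma pi_quot_add (x y : V) :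
  \pi_quot_mod (x + y) = \pi_quot_mod x + \pi_quot_mod y.
Proof. exact: (Quotient.pi_add subgroup_of_submod x y). Qed.

Lemma quot_scaleA a b q : quot_scale a (quot_scale b q) = quot_scale (a * b) q.
Proof.
by rewrite -[q]reprK (pi_quot_scale b) (pi_quot_scale a) pi_quot_scale scalerA.
Qed.

Lemma quot_scale1 : left_id 1 quot_scale.
Proof. by move=> q; rewrite -[q]reprK pi_quot_scale scale1r. Qed.

Lemma quot_scaleDr : right_distributive quot_scale +%R.
Proof.
move=> a p q; rewrite -[p]reprK -[q]reprK.
by rewrite -pi_quot_add !pi_quot_scale scalerDr pi_quot_add.
Qed.

Lemma quot_scaleDl q : {morph quot_scale^~ q : a b / a + b}.
Proof.
by move=> a b; rewrite -[q]reprK !pi_quot_scale scalerDl pi_quot_add.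
Qed.

HB.instance Definition _ := GRing.Zmodule_isLmodule.Build R quot_mod
  quot_scaleA quot_scale1 quot_scaleDr quot_scaleDl.

End QuotientModule.

Section Length.
Variables (R : pzRingType) (M : lmodType R).

(* S 0 < S 1 < ... < S l; the values of S beyond l are irrelevant. *)
Definition submod_chain (l : nat) (S : nat -> {pred M}) : Prop :=
  (forall i, (i <= l)%N -> submod_closed (S i)) /\
  (forall i, (i < l)%N ->
     {subset S i <= S i.+1} /\ ~ {subset S i.+1 <= S i}).

(* M has finite length, equal to l. *)
Definition has_length (l : nat) : Prop :=
  (exists S, submod_chain l S) /\
  (forall l' S, submod_chain l' S -> (l' <= l)%N).

End Length.

(* Ideals of R are the submodules of R^o. *)
Section Ideals.
Variable R : comNzRingType.
Implicit Types A B G : {pred R}.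

Definition ideal_gen G : {pred R^o} := fun f =>
  `[< exists2 s : seq (R * R), (forall p, p \in s -> p.2 \in G)
        & f = \sum_(p <- s) p.1 * p.2 >].

Lemma ideal_gen_submod G : submod_closed (ideal_gen G).
Proof.
split; first by apply/asboolP; exists [::]; rewrite ?big_nil.
move=> a _ _ /asboolP[s sG ->] /asboolP[t tG ->]; apply/asboolP.
exists ([seq (a * p.1, p.2) | p <- s] ++ t).
  by move=> p; rewrite mem_cat => /orP[/mapP[q /sG ? ->]|/tG].
rewrite big_cat big_map; congr (_ + _).
rewrite [LHS](_ : _ = a * \sum_(p <- s) p.1 * p.2) //.
by rewrite mulr_sumr; apply: eq_bigr => p _; rewrite mulrA.
Qed.

HB.instance Definition _ G :=
  GRing.isSubmodClosed.Build R R^o (ideal_gen G) (ideal_gen_submod G).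

Definition ideal_unit : {pred R} := predT.

Definition ideal_mul A B : {pred R^o} := ideal_gen (fun h =>
  `[< exists a b, [/\ a \in A, b \in B & h = a * b] >]).

HB.instance Definition _ A B := GRing.SubmodClosed.on (ideal_mul A B).

Definition ideal_exp A (n : nat) : {pred R} :=
  iter n (ideal_mul A) ideal_unit.

Definition integral_closure A : {pred R} := fun f =>
  `[< exists p (a : nat -> R),
        [/\ (0 < p)%N,
            forall i, (1 <= i <= p)%N -> a i \in ideal_exp A i
          & f ^+ p + \sum_(1 <= i < p.+1) a i * f ^+ (p - i) = 0] >].

End Ideals.

Section PolynomialsInTwoVariables.
Variable k : fieldType.

Definition varx : {mpoly k[2]} := 'X_(inord 0).
Definition vary : {mpoly k[2]} := 'X_(inord 1).

Definition ideal_gen2 (f g : {mpoly k[2]}) : {pred {mpoly k[2]}} :=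
  ideal_gen (mem [:: f; g]).

End PolynomialsInTwoVariables.

(* Main.v *)
Require Import Defs.
From HB Require Import structures.
From mathcomp Require Import all_boot all_order all_algebra.
From mathcomp Require Import perm zify ring.
From mathcomp.classical Require Import boolp.

Set Implicit Arguments.
Unset Strict Implicit.
Unset Printing Implicit Defensive.

Import GRing.Theory Num.Theory.
Local Open Scope ring_scope.

(** The ideals J_i and the maximal ideal are monomial, and so are all their
    products; the length of R modulo a monomial ideal is the number of
    monomials outside it ([length_monomial_quotient]).  So the theorem counts
    lattice points.

    The integral closure of (x^c, y^d) is spanned by the monomials x^a y^b with
    a d + b c >= c d ([integral_closure_powers]).  One inclusion holds because
    the weight a d + b c defines a filtration that is multiplicative on lowest
    parts, so an integral equation cannot be satisfied by an element of too
    small weight ([integral_closure_weight_ge]).  For the other one, let K be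
    the span of these monomials and A = (x^c, y^d).  Every monomial of weight at
    least 2 c d is divisible by x^c or by y^d with quotient in K, so K K = A K,
    and the determinant trick makes every element of K integral over A
    ([integral_closure_det]).  The maximal ideal M has the same description,
    with c = d = 1 ([maximal_ideal_newton]).

    Hence I^m M^n is the monomial ideal of a Minkowski sum of half planes
    a d + b c >= c d, one for each pair (c, d) of a list L consisting of m
    copies of each (c_i, d_i) and n copies of (1, 1).  Sorting L by decreasing
    slope, the boundary of the lattice points of this sum is obtained by placing
    the individual discrete edges one after another ([stair_cons]): no lattice
    point is lost when the real Newton polygons are added.  Counting column by
    column, an edge (c, d) has (c d + c + d - gcd(c, d)) / 2 lattice points
    under it ([area_edge]), and it stands on a rectangle of width c whose height
    is the sum of the heights of the later edges.  For slope-sorted edges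
    p before q the rectangle has area p1 q2 = min (p1 q2, p2 q1), which gives
    the formula
      2 length = sum over p, q in L of min (p1 q2, p2 q1)
                 + sum over p in L of (p1 + p2 - gcd(p1, p2)),
    symmetric in the list ([colength_newton]).  Evaluating it on L gives the
    polynomial in m and n; the terms min (c_i, d_i) against the copies of (1, 1)
    are c_i up to the index s and d_i beyond it. *)

(** * Monomial ideals and Minkowski sums *)

Section Supports.
Variables (n : nat) (k : fieldType).
Implicit Types (f g : {mpoly k[n]}) (S T U : 'X_{1..n} -> Prop).

Definition supported S f := forall m, m \in msupp f -> S m.

Lemma supported_sub S T f : (forall m, S m -> T m) ->
  supported S f -> supported T f.
Proof. by move=> ST Sf m /Sf /ST. Qed.

Lemma supported0 S : supported S 0.
Proof. by move=> m; rewrite -mpolyC0 msupp0. Qed.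

Lemma supportedD S f g : supported S f -> supported S g -> supported S (f + g).
Proof. by move=> Sf Sg m /msuppD_le; rewrite mem_cat => /orP[/Sf|/Sg]. Qed.

Lemma supportedN S f : supported S f -> supported S (- f).
Proof. by move=> Sf m; rewrite (perm_mem (msuppN f)) => /Sf. Qed.

Lemma supported_sum S (I : eqType) (s : seq I) (P : pred I)
    (F : I -> {mpoly k[n]}) :
  (forall i, i \in s -> P i -> supported S (F i)) ->
  supported S (\sum_(i <- s | P i) F i).
Proof.
move=> SF; rewrite big_seq_cond; apply: (big_ind (supported S)).
- exact: supported0.
- exact: supportedD.
- by move=> i /andP[]; apply: SF.
Qed.

Lemma supportedM S T U f g : (forall a b, S a -> T b -> U (a + b)%MM) ->
  supported S f -> supported T g -> supported U (f * g).
Proof.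
move=> STU Sf Tg m /msuppM_le /allpairsP[[a b] /= [af bg ->]].
by apply: STU; [apply: Sf | apply: Tg].
Qed.

Lemma supportedZX S (c : k) m : S m -> supported S (c *: 'X_[m]).
Proof. by move=> Sm a /msuppZ_le; rewrite msuppX inE => /eqP->. Qed.

Lemma supportedX S m : S m -> supported S 'X_[m].
Proof. by move=> Sm; rewrite -['X_[_]]scale1r; apply: supportedZX. Qed.

Lemma supported_not S T f : (forall m, S m -> ~ T m) ->
  supported S f -> supported T f -> f = 0.
Proof.
move=> ST Sf Tf; apply: msuppnil0; case E : (msupp f) => [//|m s].
have mf : m \in msupp f by rewrite E mem_head.
by case: (ST m (Sf m mf) (Tf m mf)).
Qed.

End Supports.

Section MinkowskiSum.
Variable n : nat.
Implicit Types A B C : 'X_{1..n} -> Prop.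

Definition minksum A B : 'X_{1..n} -> Prop :=
  fun m => exists a b, [/\ A a, B b & m = (a + b)%MM].

Definition minksum0 : 'X_{1..n} -> Prop := fun m => m = 0%MM.

Lemma minksumC : commutative minksum.
Proof.
by move=> A B; apply/funext => m; apply/propext; split=> -[a [b [? ? ->]]];
   exists b, a; rewrite addmC.
Qed.

Lemma minksumA : associative minksum.
Proof.
move=> A B C; apply/funext => m; apply/propext; split.
  move=> [a [_ [Aa [b [c [Bb Cc ->]]] ->]]].
  by exists (a + b)%MM, c; rewrite addmA; split=> //; exists a, b.
move=> [_ [c [[a [b [Aa Bb ->]]] Cc ->]]].
by exists a, (b + c)%MM; rewrite addmA; split=> //; exists b, c.
Qed.

Lemma minksum0m : left_id minksum0 minksum.
Proof.
move=> A; apply/funext => m; apply/propext; split.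
  by move=> [_ [b [-> Ab ->]]]; rewrite add0m.
by move=> Am; exists 0%MM, m; rewrite add0m.
Qed.

HB.instance Definition _ := Monoid.isComLaw.Build ('X_{1..n} -> Prop)
  minksum0 minksum minksumA minksumC minksum0m.

(** Monomial ideals correspond to up-closed sets of exponents, but Minkowski
    sum with its neutral element {0} is a monoid law only on all sets.  So sets
    of generating exponents are kept as they are, and [up] closes them. *)
Definition up A : 'X_{1..n} -> Prop := fun m => exists2 a, A a & (a <= m)%MM.

Lemma up_self A m : A m -> up A m.
Proof. by move=> Am; exists m; rewrite ?lepm_refl. Qed.

Lemma up_le A m m' : (m <= m')%MM -> up A m -> up A m'.
Proof. by move=> mm' [a Aa am]; exists a => //; apply: lepm_trans mm'. Qed.

Lemma up_minksumP A B m :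
  up (minksum A B) m <-> exists a b, [/\ up A a, up B b & m = (a + b)%MM].
Proof.
split.
  move=> [z [a [b [Aa Bb ->{z}]]] abm].
  have am := lepm_trans (lem_addr a b) abm.
  exists a, (m - a)%MM; split; [exact: up_self| |by rewrite addmC submK].
  exists b => //; apply/mnm_lepP => i; rewrite mnmBE.
  by have /mnm_lepP/(_ i) := abm; rewrite mnmDE; lia.
move=> [a1 [b1 [[a Aa /mnm_lepP aa] [b Bb /mnm_lepP bb] ->]]].
exists (a + b)%MM; first by exists a, b.
by apply/mnm_lepP => i; rewrite !mnmDE leq_add.
Qed.

End MinkowskiSum.

Section MonomialIdeals.
Variables (n : nat) (k : fieldType).
Local Notation R := {mpoly k[n]}.
Implicit Types (A B : 'X_{1..n} -> Prop) (f g : R).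

Definition mon_ideal A : {pred R} := fun f => `[< supported (up A) f >].

Lemma mon_idealP A f : reflect (supported (up A) f) (f \in mon_ideal A).
Proof. exact: asboolP. Qed.

Lemma mon_ideal_submod A : submod_closed (mon_ideal A : {pred R^o}).
Proof.
split; first exact: (introT (mon_idealP A 0) (supported0 _)).
move=> a f g /(elimT (mon_idealP A _)) Af /(elimT (mon_idealP A _)) Ag.
apply: (introT (mon_idealP A _)); apply: supportedD => //.
apply: (supportedM (S := fun=> True) _ _ Af) => // b m _.
by apply: up_le; apply: lem_addl.
Qed.

(** Ideals are boolean predicates up to extensionality, so an ideal appearing
    in a product or a power can be rewritten once it is computed. *)
Lemma pred_eq_sub (P Q : {pred R}) :
  {subset P <= Q} -> {subset Q <= P} -> P = Q.
Proof.
by move=> PQ QP; apply/funext => f; apply/idP/idP; [apply: PQ | apply: QP].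
Qed.

Lemma ideal_gen_min (G J : {pred R}) : submod_closed (J : {pred R^o}) ->
  {subset G <= J} -> {subset ideal_gen G <= J}.
Proof.
move=> [J0 JD] GJ f /asboolP[s sG ->]; rewrite big_seq.
apply: (big_ind (fun f => f \in J)) => // [x y Jx Jy|p ps].
  by rewrite -[x]mul1r; apply: JD.
by rewrite -[_ * _]addr0; apply: JD => //; apply/GJ/sG.
Qed.

Lemma mem_ideal_gen (G : {pred R}) f : f \in G -> f \in ideal_gen G.
Proof.
move=> Gf; apply/asboolP; exists [:: (1, f)]; last by rewrite big_seq1 mul1r.
by move=> p; rewrite inE => /eqP->.
Qed.

(** Every f is the sum of its terms, and each term lies in J as a multiple of
    some X^a with a in A. *)
Lemma mon_ideal_sub A (J : {pred R}) : submod_closed (J : {pred R^o}) ->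
  (forall m, A m -> 'X_[m] \in J) -> {subset mon_ideal A <= J}.
Proof.
move=> [J0 JD] AJ f /mon_idealP Af; rewrite [f]mpolyE big_seq.
apply: (big_ind (fun f => f \in J)) => // [x y Jx Jy|m /Af[a Aa am]].
  by rewrite -[x]mul1r; apply: JD.
rewrite -(submK am) mpolyXD scalerAl -[_ * _]addr0.
by apply: JD => //; apply: AJ.
Qed.

Lemma ideal_gen_monomials (G : {pred R}) A :
  (forall f, f \in G <-> exists2 m, A m & f = 'X_[m]) ->
  ideal_gen G = mon_ideal A.
Proof.
move=> GA; apply: pred_eq_sub.
  apply: ideal_gen_min (mon_ideal_submod A) _ => g /GA[m Am ->].
  by apply/mon_idealP; apply: supportedX; apply: up_self.
apply: mon_ideal_sub (ideal_gen_submod G) _ => m Am.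
by apply: mem_ideal_gen; apply/GA; exists m.
Qed.

Lemma mon_idealM A B :
  ideal_mul (mon_ideal A) (mon_ideal B) = mon_ideal (minksum A B).
Proof.
apply: pred_eq_sub.
  apply: ideal_gen_min (mon_ideal_submod _) _ => _ /asboolP[g [h [Ag Bh ->]]].
  move/mon_idealP: Ag => Ag; move/mon_idealP: Bh => Bh.
  by apply/mon_idealP; apply: supportedM Ag Bh => a b Aa Bb;
     apply/up_minksumP; exists a, b.
apply: mon_ideal_sub (ideal_gen_submod _) _ => _ [a [b [Aa Bb ->]]].
apply/mem_ideal_gen/asboolP; exists 'X_[a], 'X_[b]; rewrite mpolyXD.
by split=> //; apply/mon_idealP; apply: supportedX; apply: up_self.
Qed.

Lemma mon_ideal_unit : @ideal_unit R = mon_ideal (@minksum0 n).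
Proof.
apply: pred_eq_sub => // f _; apply/mon_idealP => m _; exists 0%MM => //.
by apply/mnm_lepP => i; rewrite mnm0E.
Qed.

Lemma big_mon_ideal (I : Type) (s : seq I) (A : I -> 'X_{1..n} -> Prop) :
  \big[@ideal_mul R/@ideal_unit R]_(i <- s) mon_ideal (A i) =
  mon_ideal (\big[@minksum n/@minksum0 n]_(i <- s) A i).
Proof.
elim: s => [|i s IHs]; first by rewrite !big_nil mon_ideal_unit.
by rewrite !big_cons IHs mon_idealM.
Qed.

Lemma ideal_exp_mon A e :
  ideal_exp (mon_ideal A) e = mon_ideal (\big[@minksum n/@minksum0 n]_(i < e) A).
Proof.
elim: e => [|e IHe]; first by rewrite big_ord0 -mon_ideal_unit.
by rewrite big_ord_recl -mon_idealM -IHe.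
Qed.

End MonomialIdeals.

(** * The length of a quotient by a monomial ideal *)

Section MonomialQuotient.
Variables (n : nat) (k : fieldType).
Local Notation R := {mpoly k[n]}.
Variables (N : submodClosed R^o) (E : 'X_{1..n} -> Prop).
Hypothesis NE : forall f : R, (f : R^o) \in N <-> supported E f.
Local Notation Q := (quot_mod N).
Local Open Scope quotient_scope.

Lemma pi_quot_eq0 (f : R^o) : \pi_Q f = 0 <-> f \in N.
Proof.
have pi0 : \pi_Q (0 : R^o) = 0.
  by apply: (addrI (\pi_Q 0)); rewrite -pi_quot_add !addr0.
rewrite -pi0 -[f in f \in N]subr0 -eq_quot_modE.
by split=> [->|/eqP].
Qed.

Lemma pi_quot_sum (I : Type) (s : seq I) (F : I -> R^o) :
  \pi_Q (\sum_(i <- s) F i) = \sum_(i <- s) \pi_Q (F i).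
Proof.
apply: (big_morph (fun f => \pi_Q f) (@pi_quot_add _ _ N)).
by apply/pi_quot_eq0; apply: rpred0.
Qed.

Variable s : seq 'X_{1..n}.
Hypothesis sE : forall m, m \in s <-> ~ E m.

(** A strictly increasing chain of submodules yields vectors v_i in S_(i+1) but
    not in S_i.  They are linearly independent over k, because in a dependency
    the last vector would lie in the submodule below it.  Taking coefficients at
    the exponents in s embeds the quotient in k^(size s), so there are at most
    size s of them. *)
Lemma quot_chain_le l S : @submod_chain R Q l S -> (l <= size s)%N.
Proof.
move=> [S_submod S_strict].
pose new_in (i : 'I_l) x := x \in S i.+1 /\ x \notin S i.
have [v vP] : {v : 'I_l -> Q & forall i, new_in i (v i)}.
  apply: boolp.choice => i.
  have [_ /existsNP[v]] := S_strict i (ltn_ord i).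
  by move=> /not_implyP[? /negP]; exists v.
have S_mono i j : (i <= j <= l)%N -> {subset S i <= S j}.
  elim: j => [|j IHj]; first by rewrite andbC leqn0 => /andP[_ /eqP->].
  rewrite leq_eqVlt => /andP[/predU1P[-> _ x|ij jl x Sx]] //.
  by apply: (S_strict j jl).1; apply: IHj Sx; rewrite -ltnS ij ltnW.
pose A : 'M[k]_(l, size s) :=
  \matrix_(i, j) (repr (v i) : R)@_(nth 0%MM s j).
suff: row_free A by move=> /eqP <-; apply: rank_leq_col.
apply: inj_row_free => u uA0; apply/rowP => i0; rewrite mxE.
apply/eqP/negP => /negP ui0.
(* The last vector in a nontrivial dependency. *)
case: (@arg_maxnP _ i0 (fun i => u 0 i != 0) (@nat_of_ord l) ui0) => i ui imax.
have sum0 : \sum_(j < l) (u 0 j)%:MP *: v j = 0.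
  under eq_bigr => j _ do rewrite -[v j]reprK.
  have -> : \sum_(j < l) (u 0 j)%:MP *: \pi_Q (repr (v j)) =
      \pi_Q (\sum_(j < l) ((u 0 j)%:MP : R) *: repr (v j)).
    rewrite pi_quot_sum; apply: eq_bigr => j _; exact: pi_quot_scale.
  apply/pi_quot_eq0/NE => m; rewrite mcoeff_msupp => mnz.
  apply: contrapT => /sE ms; move/negP: mnz; apply.
  have jm : (index m s < size s)%N by rewrite index_mem.
  have /rowP/(_ (Ordinal jm)) := uA0; rewrite !mxE => uAj0.
  apply/eqP; rewrite -[RHS]uAj0 [LHS]raddf_sum; apply: eq_bigr => j _.
  by rewrite mxE /= nth_index //; exact: mcoeffCM.
have Si := S_submod i (ltnW (ltn_ord i)).
case: (vP i) => _ /negP; apply.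
have -> : v i = - ((u 0 i)^-1)%:MP *: \sum_(j < l | j != i) (u 0 j)%:MP *: v j.
  move/eqP: sum0; rewrite (bigD1 i) //= addrC addr_eq0 => /eqP->.
  by rewrite scalerN scaleNr opprK scalerA -mpolyCM mulVf // mpolyC1 scale1r.
rewrite -[_ *: _]addr0; apply: (Si.2); last exact: Si.1.
elim/big_rec: _ => [|j x ji Sx]; first exact: Si.1.
have [->|uj] := eqVneq (u 0 j) 0; first by rewrite mpolyC0 scale0r add0r.
apply: Si.2 => //; apply: (S_mono j.+1); last by case: (vP j).
by rewrite ltn_neqAle ji [(j <= i)%N](imax _ uj) ltnW.
Qed.

Lemma supportedE_mulr m b : E m -> E (b + m)%MM.
Proof.
move=> Em; have XmN : ('X_[m] : R^o) \in N by apply/NE; apply: supportedX.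
have /NE : (('X_[b] : R) *: ('X_[m] : R^o)) \in N by apply: rpredZ.
rewrite [_ *: _](_ : _ = 'X_[b + m]); last by rewrite mpolyXD.
by apply; rewrite msuppX mem_head.
Qed.

Hypothesis s_uniq : uniq s.

(** Adding the monomials outside E in order of decreasing degree keeps the
    span an ideal at each step. *)
Definition by_degree := sort (relpre (@mdeg n) leq) s.

Lemma mem_by_degree m : (m \in by_degree) = (m \in s).
Proof. by rewrite mem_sort. Qed.

Lemma index_by_degree_le m b : m \in s -> (b + m)%MM \in s ->
  (index m by_degree <= index (b + m)%MM by_degree)%N.
Proof.
rewrite -!mem_by_degree => ms bms; rewrite leqNgt; apply/negP => lt_bm.
have := @sorted_leq_nth _ (relpre (@mdeg n) leq) _ _ 0%MM by_degree.
move=> /(_ (fun x y z => @leq_trans _ _ _) (fun x => leqnn _)).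
move=> /(_ (sort_sorted (fun x y => leq_total _ _) s)).
move=> /(_ (index (b + m)%MM by_degree) (index m by_degree)).
rewrite !inE !index_mem ms bms (ltnW lt_bm) !nth_index // => /(_ isT isT isT).
rewrite /= mdegD => le_b; have b0 : mdeg b == 0%N by lia.
by move: lt_bm; move: b0; rewrite mdeg_eq0 => /eqP->; rewrite add0m ltnn.
Qed.

Definition filtration_exp (i : nat) m :=
  E m \/ (size s - i <= index m by_degree)%N.

Lemma filtration_exp_up i m b :
  filtration_exp i m -> filtration_exp i (b + m)%MM.
Proof.
case=> [Em|im]; first by left; apply: supportedE_mulr.
have [Em|nEm] := pselect (E m); first by left; apply: supportedE_mulr.
have [Ebm|nEbm] := pselect (E (b + m)%MM); first by left.
by right; apply: (leq_trans im); apply: index_by_degree_le; apply/sE.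
Qed.

(** The members of a composition series; membership does not depend on the
    representative, since N consists of the polynomials supported on E. *)
Definition filtration (i : nat) : {pred Q} :=
  fun q => `[< supported (filtration_exp i) (repr q : R) >].

Lemma filtrationP i (f : R) :
  \pi_Q (f : R^o) \in filtration i <-> supported (filtration_exp i) f.
Proof.
have ENi : forall g : R, (g : R^o) \in N -> supported (filtration_exp i) g.
  by move=> g /NE; apply: supported_sub => m; left.
have Nf : (repr (\pi_Q (f : R^o)) : R^o) - f \in N.
  by rewrite -eq_quot_modE reprK.
split=> [/asboolP ff|ff]; last apply/asboolP.
  rewrite -[f](subKr (repr (\pi_Q (f : R^o)) : R)); apply: supportedD => //.
  by apply: supportedN; apply: ENi.
rewrite -[repr _](subrK (f : R^o)); apply: supportedD => //.
exact: ENi.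
Qed.

Lemma filtration_submod i : submod_closed (filtration i).
Proof.
have pi0 : \pi_Q (0 : R^o) = 0 by apply/pi_quot_eq0; apply: rpred0.
split; first by rewrite -pi0; apply/filtrationP; apply: supported0.
move=> a p q; rewrite -[p]reprK -[q]reprK.
move=> /filtrationP pi /filtrationP qi.
have -> : a *: \pi_Q (repr p) = \pi_Q (a *: repr p) by apply: pi_quot_scale.
rewrite -pi_quot_add.
apply/filtrationP; apply: supportedD => //.
apply: (supportedM (S := fun=> True) _ _ pi) => // b m _.
exact: filtration_exp_up.
Qed.

Lemma filtration_chain : @submod_chain R Q (size s) filtration.
Proof.
split=> [i _|i lt_is]; first exact: filtration_submod.
split.
  move=> q; rewrite -[q]reprK => /filtrationP qi; apply/filtrationP.
  apply: supported_sub qi => m [|im]; [by left|right].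
  by apply: leq_trans im; apply: leq_sub2l.
pose m := nth 0%MM by_degree (size s - i.+1).
have lt_m : (size s - i.+1 < size by_degree)%N by rewrite size_sort; lia.
have im : index m by_degree = (size s - i.+1)%N.
  by rewrite index_uniq // sort_uniq.
have nEm : ~ E m by apply/sE; rewrite -mem_by_degree mem_nth.
move=> /(_ (\pi_Q ('X_[m] : R^o))).
have -> : \pi_Q ('X_[m] : R^o) \in filtration i.+1.
  by apply/filtrationP; apply: supportedX; right; rewrite im.
move=> /(_ isT) /filtrationP /(_ m); rewrite msuppX mem_head => /(_ isT).
by case=> //; rewrite im; lia.
Qed.

Theorem length_monomial_quotient : @has_length R Q (size s).
Proof.
split; first by exists filtration; apply: filtration_chain.
exact: quot_chain_le.
Qed.

End MonomialQuotient.

(** * Powers of ideals and the determinant trick *)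

Section IdealPowers.
Variables (R : comNzRingType) (A : {pred R}).

Lemma ideal_exp_submod e : submod_closed (ideal_exp A e : {pred R^o}).
Proof. by case: e => [|e]; [split | apply: ideal_gen_submod]. Qed.

Lemma ideal_exp_add e (x y : R) : x \in ideal_exp A e -> y \in ideal_exp A e ->
  x + y \in ideal_exp A e.
Proof.
by move=> Ax Ay; rewrite -[x]mul1r; apply: (ideal_exp_submod e).2.
Qed.

Lemma ideal_exp_mul_l e (x y : R) : y \in ideal_exp A e ->
  x * y \in ideal_exp A e.
Proof.
have [A0 AD] := ideal_exp_submod e.
by move=> Ay; rewrite -[x * y]addr0; apply: AD.
Qed.

Lemma ideal_exp_sum e (I : Type) (s : seq I) (P : pred I) (F : I -> R) :
  (forall i, P i -> F i \in ideal_exp A e) ->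
  \sum_(i <- s | P i) F i \in ideal_exp A e.
Proof.
move=> AF; apply: (big_ind (fun x => x \in ideal_exp A e)) => //.
  exact: (ideal_exp_submod e).1.
exact: ideal_exp_add.
Qed.

Lemma ideal_mul_gen (B : {pred R}) (a b : R) : a \in A -> b \in B ->
  a * b \in ideal_mul A B.
Proof.
move=> Aa Bb; apply/asboolP; exists [:: (1, a * b)].
  by move=> p; rewrite inE => /eqP-> /=; apply/asboolP; exists a, b.
by rewrite big_seq1 mul1r.
Qed.

Lemma ideal_exp_mul a b (x y : R) : x \in ideal_exp A a -> y \in ideal_exp A b ->
  x * y \in ideal_exp A (a + b).
Proof.
elim: a x => [|a IHa] x; first by move=> _; rewrite add0n; apply: ideal_exp_mul_l.
move=> /asboolP[s sA ->] Ay; rewrite mulr_suml big_seq.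
apply: ideal_exp_sum => p /sA /asboolP[u [v [Au Av ->]]].
rewrite -mulrA; apply: ideal_exp_mul_l; rewrite -mulrA addSn.
by apply: ideal_mul_gen => //; apply: IHa.
Qed.

Lemma ideal_exp_antitone a b (x : R) : (b <= a)%N -> x \in ideal_exp A a ->
  x \in ideal_exp A b.
Proof.
move=> /subnK <-; elim: (a - b)%N x => [//|c IHc] x /asboolP[s sA ->].
apply: IHc; rewrite big_seq.
apply: ideal_exp_sum => p /sA /asboolP[u [v [_ Av ->]]].
by apply: ideal_exp_mul_l; apply: ideal_exp_mul_l.
Qed.

Lemma ideal_exp1 (x : R) : x \in A -> x \in ideal_exp A 1.
Proof. by move=> Ax; rewrite -[x]mulr1; apply: ideal_mul_gen. Qed.

(** Homogeneous elements of degree e of the ring R[A t, X], read at t = 1: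
    integral equations of degree e over A are the monic ones of degree e.  For
    j > e the truncated subtraction leaves the coefficient unconstrained, which
    is consistent with products by [ideal_exp_antitone]. *)
Definition rees_poly e (q : {poly R}) := forall j, q`_j \in ideal_exp A (e - j)%N.

Lemma rees_polyM e e' q q' : rees_poly e q -> rees_poly e' q' ->
  rees_poly (e + e') (q * q').
Proof.
move=> eq eq' j; rewrite coefM; apply: ideal_exp_sum => i _.
apply: (@ideal_exp_antitone ((e - i) + (e' - (j - i)))).
  by have := ltn_ord i; lia.
exact: ideal_exp_mul.
Qed.

Lemma rees_poly_prod (I : Type) (s : seq I) (F : I -> {poly R}) :
  (forall i, rees_poly 1 (F i)) -> rees_poly (size s) (\prod_(i <- s) F i).
Proof.
move=> F1; elim: s => [|i s IHs]; first by move=> j; rewrite big_nil.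
by rewrite big_cons; apply: (rees_polyM (e := 1)).
Qed.

(** The entries of X - B are homogeneous of degree 1, so its determinant is
    homogeneous of degree N. *)
Lemma rees_poly_char_poly N (B : 'M[R]_N) : (forall i j, B i j \in A) ->
  rees_poly N (char_poly B).
Proof.
move=> BA; rewrite /char_poly /determinant => j; rewrite coef_sum.
apply: ideal_exp_sum => s _.
have -> : (-1) ^+ odd_perm s = ((-1) ^+ odd_perm s)%:P :> {poly R}.
  by rewrite rmorphXn rmorphN rmorph1.
rewrite coefCM; apply: ideal_exp_mul_l.
have := @rees_poly_prod _ (index_enum 'I_N) (fun i => char_poly_mx B i (s i)).
rewrite /index_enum -enumT size_enum_ord; apply=> i e; rewrite !mxE.
case: e => [|e]; last by rewrite subSS sub0n.
rewrite subn0 coefB coefC -mulN1r.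
apply: ideal_exp_add; last by apply: ideal_exp_mul_l; apply: ideal_exp1.
by rewrite coefMn coefX mul0rn; apply: (ideal_exp_submod 1).1.
Qed.

End IdealPowers.

(** The determinant trick: f is an eigenvalue of B with eigenvector v, so it is
    a root of the characteristic polynomial of B, which is an integral equation
    over the ideal A. *)
Lemma integral_closure_det (R : idomainType) (A : {pred R}) N
    (v : 'I_N -> R) (B : 'M[R]_N) (f : R) :
  (0 < N)%N -> (exists i, v i != 0) -> (forall i j, B i j \in A) ->
  (forall i, f * v i = \sum_j B i j * v j) ->
  f \in integral_closure A.
Proof.
move=> N0 [i0 vi0] BA fv; apply/asboolP.
have pf0 : (char_poly B).[f] = 0.
  have -> : (char_poly B).[f] = \det (f%:M - B).
    rewrite -[LHS]/(horner_eval f _) -det_map_mx; congr (\det _).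
    apply/matrixP => i j; rewrite !mxE /= /horner_eval hornerD hornerN hornerC.
    by rewrite hornerMn hornerX.
  apply/eqP; rewrite -(mulIr_eq0 _ (mulIf vi0)); apply/eqP.
  have fBv : (f%:M - B) *m (\col_i v i) = 0.
    apply/colP => i; rewrite mulmxBl mul_scalar_mx !mxE fv.
    by under [X in _ - X]eq_bigr do rewrite mxE; rewrite subrr.
  have := congr1 (fun x => (\adj (f%:M - B) *m x) i0 0) fBv.
  by rewrite mulmxA mul_adj_mx mulmx0 mul_scalar_mx !mxE.
exists N, (fun i => (char_poly B)`_(N - i)%N); split=> //.
  move=> i /andP[_ iN]; have := rees_poly_char_poly BA (N - i)%N.
  by rewrite subKn.
rewrite -[RHS]pf0 horner_coef size_char_poly.
rewrite -(big_mkord xpredT (fun i => (char_poly B)`_i * f ^+ i)).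
have lead1 : (char_poly B)`_N = 1.
  by have /monicP := char_poly_monic B; rewrite lead_coefE size_char_poly.
rewrite [RHS]big_nat_recr //= lead1 mul1r [RHS]addrC big_add1; congr (_ + _).
by rewrite [RHS]big_nat_rev; apply: eq_bigr => i _; rewrite add0n.
Qed.

(** * Integral elements and weights *)

Section WeightFiltration.
Variables (n : nat) (k : fieldType) (w : 'X_{1..n} -> nat).
Local Notation R := {mpoly k[n]}.
Hypothesis wD : forall a b, w (a + b)%MM = (w a + w b)%N.
Implicit Types (f g : R).

Definition weight_ge q f := supported (fun m => (q <= w m)%N) f.

Lemma weight_geM q q' f g : weight_ge q f -> weight_ge q' g ->
  weight_ge (q + q') (f * g).
Proof. by apply: supportedM => a b; rewrite wD; apply: leq_add. Qed.

Lemma weight_geX q f e : weight_ge q f -> weight_ge (e * q) (f ^+ e).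
Proof.
move=> fq; elim: e => [|e IHe]; first by move=> m _.
by rewrite exprS mulSn; apply: weight_geM.
Qed.

Lemma weight_ge_le q q' f : (q <= q')%N -> weight_ge q' f -> weight_ge q f.
Proof. by move=> qq'; apply: supported_sub => m; apply: leq_trans. Qed.

Lemma ideal_exp_weight_ge (A : {pred R}) q e g :
  (forall h, h \in A -> weight_ge q h) ->
  g \in ideal_exp A e -> weight_ge (e * q) g.
Proof.
move=> Aq; elim: e g => [|e IHe] g; first by move=> _ m.
move=> /asboolP[s sA ->].
apply: supported_sum => p /sA /asboolP[a [b [Aa Ab ->]]] _.
rewrite -[(e.+1 * q)%N]add0n; apply: weight_geM => //.
by rewrite mulSn; apply: weight_geM; [apply: Aq | apply: IHe].
Qed.

(** Together with the absence of zero divisors, this makes the lowest part of a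
    power the power of the lowest part. *)
Lemma homogeneousX j f e : supported (fun m => w m = j) f ->
  supported (fun m => w m = e * j)%N (f ^+ e).
Proof.
move=> fj; elim: e => [|e IHe].
  move=> m; rewrite expr0 -mpolyC1 msupp1 inE => /eqP->.
  by have := wD 0%MM 0%MM; rewrite addm0; lia.
by rewrite exprS; apply: supportedM fj IHe => a b aj be; rewrite wD aj be mulSn.
Qed.

(** Weights form a valuation: if f had a nonzero part f0 of weight j < q, then
    f^p would have the nonzero part f0^p in weight p j, whereas each term
    a_i f^(p-i) of the integral equation has weight at least
    i q + (p - i) j > p j.  The bound on the weight of f is thus raised from j to
    j + 1 until it reaches q. *)
Lemma integral_closure_weight_ge (A : {pred R}) q f :
  (forall h, h \in A -> weight_ge q h) ->
  f \in integral_closure A -> weight_ge q f.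
Proof.
move=> Aq /asboolP[p [a [p0 aA eq0]]].
suff: forall j, (j <= q)%N -> weight_ge j f by apply.
elim=> [|j IHj] jq; first by move=> m _.
have fj : weight_ge j f by apply: IHj; apply: ltnW.
(* The part of weight exactly j, and the part of greater weight. *)
pose f0 := \sum_(m <- msupp f | w m == j) f@_m *: 'X_[m].
pose f1 := \sum_(m <- msupp f | w m != j) f@_m *: 'X_[m].
have fE : f = f0 + f1 by rewrite {1}[f]mpolyE (bigID (fun m => w m == j)).
have f0j : supported (fun m => w m = j) f0.
  by apply: supported_sum => m _ /eqP wm; apply: supportedZX.
have f1j : weight_ge j.+1 f1.
  apply: supported_sum => m mf wm; apply: supportedZX.
  by rewrite ltn_neqAle eq_sym wm; apply: fj.
suff f00 : f0 = 0 by rewrite fE f00 add0r.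
have f0j' : weight_ge j f0 by apply: supported_sub f0j => m ->.
have fp : weight_ge (p * j).+1 (f ^+ p).
  have -> : f ^+ p = - \sum_(1 <= i < p.+1) a i * f ^+ (p - i).
    by apply/eqP; rewrite -addr_eq0 eq0.
  apply: supportedN; apply: supported_sum => i; rewrite mem_index_iota => ip _.
  apply: (@weight_ge_le _ (i * q + (p - i) * j)).
    move: ip => /andP[i0 ip]; rewrite -{1}(subnKC (m := i) (n := p)) //.
    by rewrite mulnDl -addSn leq_add2r ltn_pmul2l.
  apply: weight_geM; last exact: weight_geX.
  by apply: ideal_exp_weight_ge Aq _; apply: aA.
have f0p : weight_ge (p * j).+1 (f0 ^+ p).
  have -> : f0 ^+ p = f ^+ p - (f ^+ p - f0 ^+ p) by rewrite subKr.
  apply: supportedD => //; apply: supportedN.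
  rewrite subrXX {1}fE addrAC subrr add0r mulr_sumr.
  apply: supported_sum => i _ _.
  apply: (@weight_ge_le _ (j.+1 + ((p.-1 - i) * j + i * j))).
    rewrite -mulnDl subnK; last by have := ltn_ord i; lia.
    by rewrite -{1}(prednK p0) mulSn addSn.
  by apply: weight_geM => //; apply: weight_geM; apply: weight_geX.
have f0p0 : f0 ^+ p = 0.
  by apply: supported_not (homogeneousX (e := p) f0j) f0p => m ->; rewrite ltnn.
by move/eqP: f0p0; rewrite expf_eq0 p0 => /eqP.
Qed.

End WeightFiltration.

(** * Lattice points under a staircase *)

Section Staircase.
Local Open Scope nat_scope.
Implicit Types (p q : nat * nat) (L : seq (nat * nat)).

Definition ceil_div n c := (n + c.-1) %/ c.

Lemma ceil_div_le n c b : 0 < c -> (ceil_div n c <= b) = (n <= b * c).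
Proof.
move=> c0; rewrite /ceil_div -ltnS ltn_divLR // mulSn.
by case: c c0 => // c _; rewrite /= addnC addSn ltnS leq_add2l.
Qed.

Lemma ceil_div_ge n c : 0 < c -> n <= ceil_div n c * c.
Proof. by move=> c0; rewrite -ceil_div_le. Qed.

(** The least b such that (a, b) is on or above the segment from (0, p.2) to
    (p.1, 0), and 0 in the columns beyond it. *)
Definition edge p a := ceil_div ((p.1 - a) * p.2) p.1.

Lemma edge_le p a b : 0 < p.1 ->
  (edge p a <= b) = (p.1 * p.2 <= a * p.2 + b * p.1).
Proof.
by move=> p0; rewrite ceil_div_le // mulnBl leq_subLR.
Qed.

Lemma count_multiples k g : 0 < k -> \sum_(0 <= u < g * k) (k %| u) = g.
Proof.
move=> k0; elim: g => [|g IHg]; first by rewrite big_geq.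
rewrite (big_cat_nat (n := g * k)) //= ?leq_mul2r ?leqnSn ?orbT // IHg.
rewrite -{1}[g * k]add0n big_addn mulSn addnK big_ltn // add0n dvdn_mull //.
rewrite big_nat_cond big1 ?addn1 // => u; rewrite andbT => /andP[u0 uk].
by rewrite dvdn_addl ?dvdn_mull // gtnNdvd.
Qed.

(** With g the gcd and c = k g, the condition c | u d means k | u. *)
Lemma count_integral_points c d : 0 < c ->
  \sum_(0 <= u < c) (c %| u * d) = gcdn c d.
Proof.
move=> c0; set g := gcdn c d.
have g0 : 0 < g by rewrite gcdn_gt0 c0.
have [q cE] := dvdnP (dvdn_gcdl c d); have [e dE] := dvdnP (dvdn_gcdr c d).
rewrite -/g in cE dE.
have q0 : 0 < q by rewrite cE in c0; case: q c0 {cE}.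
have qe : coprime q e.
  by rewrite /coprime -(eqn_pmul2r g0) muln_gcdl -cE -dE mul1n.
rewrite -[RHS](count_multiples g q0) [in X in index_iota _ X]cE mulnC.
by apply: eq_bigr => u _; rewrite dE mulnA cE dvdn_pmul2r // Gauss_dvdl.
Qed.

(** The two quotients u d / c and (c - u) d / c add up to d; rounding both up
    adds 1 unless they are integers. *)
Lemma ceil_div_compl c d u : 0 < u < c ->
  ceil_div (u * d) c + ceil_div ((c - u) * d) c + (c %| u * d) = d.+1.
Proof.
move=> /andP[u0 uc]; have c0 := leq_ltn_trans (leq0n u) uc.
have ge1 := ceil_div_ge (u * d) c0; have ge2 := ceil_div_ge ((c - u) * d) c0.
have [dv|ndv] := boolP (c %| u * d).
  have [k kE] := dvdnP dv.
  have -> : ceil_div (u * d) c = k.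
    by apply/eqP; rewrite eqn_leq ceil_div_le // kE leqnn -(leq_pmul2r c0) -kE.
  set B := ceil_div _ c in ge2 *; have -> : B = d - k.
    apply/eqP; rewrite eqn_leq {1}/B ceil_div_le // !mulnBl kE mulnC leqnn /=.
    rewrite leq_subLR -(leq_pmul2r c0) mulnDl -kE; nia.
  have : k <= d by rewrite -(leq_pmul2r c0) -kE mulnC leq_mul // ltnW.
  lia.
set A := ceil_div (u * d) c in ge1 *; set B := ceil_div _ c in ge2 *.
have A1 : A.-1 * c < u * d.
  rewrite ltnNge -ceil_div_le // -/A -ltnNge.
  have : A != 0; last lia.
  by apply: contraNneq ndv => A0; move: ge1; rewrite A0 leqn0 => /eqP->.
have B1 : B.-1 * c < (c - u) * d.
  rewrite ltnNge -ceil_div_le // -/B -ltnNge.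
  have : B != 0; last lia.
  apply: contraNneq ndv => B0; move: ge2; rewrite B0 mul0n leqn0 muln_eq0.
  by rewrite subn_eq0 leqNgt uc => /eqP->; rewrite muln0.
have ge1' : u * d < A * c.
  by rewrite ltn_neqAle ge1 andbT; apply: contraNneq ndv => ->; rewrite dvdn_mull.
rewrite addn0; apply/eqP; rewrite eqn_leq; apply/andP; split.
  have : (A.-1 + B.-1) * c < d * c by nia.
  by rewrite ltn_pmul2r //; lia.
have : d * c < (A + B) * c by nia.
by rewrite ltn_pmul2r.
Qed.

(** The segment cuts the rectangle of sides p.1 and p.2 into two congruent
    halves: pair column u with column c - u. *)
Lemma area_edge p : 0 < p.1 ->
  2 * (\sum_(0 <= a < p.1) edge p a) + gcdn p.1 p.2 =
    p.1 * p.2 + p.1 + p.2.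
Proof.
case: p => c d /= c0; rewrite -(count_integral_points d c0).
rewrite [in 2 * _]big_ltn // [X in _ + X]big_ltn // mul0n dvdn0 mulnDr -addnA.
have -> : edge (c, d) 0 = d.
  by apply/eqP; rewrite eqn_leq edge_le //= addnC mulnC leq_addr /=
     -(leq_pmul2r c0) (leq_trans _ (ceil_div_ge _ _)) // subn0 mulnC.
set S := \sum_(1 <= a < c) _.
suff: 2 * S + \sum_(1 <= u < c) (c %| u * d) = c.-1 * d.+1 by nia.
rewrite mul2n -addnn {1}/S big_nat_rev /= -!big_split /=.
rewrite (eq_big_nat _ _ (F2 := fun=> d.+1)) ?sum_nat_const_nat ?subn1 //.
move=> u uc; rewrite -(ceil_div_compl d uc) /edge /=.
congr (ceil_div (_ * _) _ + _ + _).
by lia.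
Qed.

(** The staircase obtained by joining the edges of the list, the first one
    leftmost, on top of the heights of the remaining ones. *)
Fixpoint stair L a :=
  if L is p :: L' then
    if a < p.1 then edge p a + \sum_(q <- L') q.2 else stair L' (a - p.1)
  else 0.

(** Slopes are compared by cross multiplication; this is not transitive in the
    presence of pairs with zero entries. *)
Definition steeper p q := p.1 * q.2 <= p.2 * q.1.

Definition pos_pair p := (0 < p.1) && (0 < p.2).

Lemma steeper_trans p q r : pos_pair p -> pos_pair q -> pos_pair r ->
  steeper p q -> steeper q r -> steeper p r.
Proof.
by case: p q r => [? ?] [? ?] [? ?]; rewrite /steeper /pos_pair /=; nia.
Qed.

Lemma steeper_total : total steeper.
Proof.
move=> [a b] [c d]; rewrite /steeper /= [c * b]mulnC [d * a]mulnC.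
exact: leq_total.
Qed.

Lemma edgeP p a : 0 < p.1 -> p.1 * p.2 <= a * p.2 + edge p a * p.1.
Proof. by move=> p0; rewrite -edge_le. Qed.

Lemma stair_le_height L a : all pos_pair L -> stair L a <= \sum_(q <- L) q.2.
Proof.
elim: L a => [|q L IHL] a //= /andP[/andP[q1 q2] posL]; rewrite big_cons.
case: ltnP => aq; last by rewrite (leq_trans (IHL _ posL)) ?leq_addl.
by rewrite leq_add2r edge_le // mulnC leq_addl.
Qed.

Lemma stair_nonincreasing L a u : all pos_pair L ->
  stair L (a + u) <= stair L a.
Proof.
elim: L a => [|q L IHL] a //= /andP[/andP[q1 q2] posL].
case: (ltnP a) => aq; last first.
  by rewrite ltnNge (leq_trans aq (leq_addr _ _)) /= -addnBAC // IHL.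
case: ltnP => auq.
  rewrite leq_add2r edge_le //; have := edgeP a q1; nia.
by rewrite (leq_trans (stair_le_height _ posL)) ?leq_addl.
Qed.

(** A staircase all of whose edges are less steep than p lies above the line
    of slope p through its top left corner.  The corner has integral height, so
    no rounding enters. *)
Lemma height_le_slope p L v : pos_pair p -> all pos_pair L ->
    all (steeper p) L ->
  (\sum_(q <- L) q.2) * p.1 <= stair L v * p.1 + v * p.2.
Proof.
move=> /andP[p1 p2]; elim: L v => [|q L IHL] v /=; first by rewrite big_nil.
move=> /andP[/andP[q1 q2] posL] /andP[pq pL]; rewrite big_cons.
rewrite /steeper in pq; case: ltnP => vq.
  set D := \sum_(_ <- _) _; set E := edge q v.
  suff : q.1 * q.2 * p.1 <= (E * p.1 + v * p.2) * q.1.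
    move=> le_q; have : q.2 * p.1 <= E * p.1 + v * p.2.
      by rewrite -(leq_pmul2r q1); lia.
    by lia.
  have qE : q.1 * q.2 <= v * q.2 + E * q.1 by apply: edgeP.
  nia.
have := IHL (v - q.1) posL pL.
set D := \sum_(_ <- _) _; set E := stair _ _.
have : q.2 * p.1 <= p.2 * q.1 by rewrite mulnC.
nia.
Qed.

(** A staircase whose edges are less steep than p descends by at most
    ceil (u p.2 / p.1) over u columns.  Rounding up is harmless in each case:
    within an edge the slope of that edge bounds the descent; across the end of
    an edge [height_le_slope] applies from the corner. *)
Lemma stair_slope p L e u t : pos_pair p -> all pos_pair L ->
    all (steeper p) L ->
  u * p.2 <= t * p.1 -> stair L e <= stair L (e + u) + t.
Proof.
move=> pp; have /andP[p1 p2] := pp; move=> posL pL ut.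
elim: L e posL pL => [|q L IHL] e //=.
move=> /andP[/andP[q1 q2] posL] /andP[pq pL]; rewrite /steeper in pq.
case: (ltnP e) => eq1; last first.
  rewrite ltnNge (leq_trans eq1 (leq_addr _ _)) /=.
  by rewrite -addnBAC // IHL.
case: ltnP => euq.
  have uq : u * q.2 <= t * q.1 by rewrite -(leq_pmul2r p1); nia.
  rewrite addnAC leq_add2r edge_le // mulnDl.
  by have := edgeP (e + u) q1; rewrite mulnDl; lia.
have := height_le_slope (e + u - q.1) pp posL pL.
set D := \sum_(_ <- _) _; set H := stair _ _ => DH.
have DHt : D <= H + t by rewrite -(leq_pmul2r p1); nia.
suff : edge q e <= H + t - D by lia.
rewrite edge_le // -(leq_pmul2r p1).
(* Here w is the distance to the end of the edge, v the overshoot beyond it. *)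
have [w wE] : {w | q.1 = e + w} by exists (q.1 - e); lia.
have [v vE] : {v | u = v + w} by exists (e + u - q.1); lia.
have [z zE] : {z | H + t = D + z} by exists (H + t - D); lia.
rewrite zE addKn; have vE' : e + u - q.1 = v by lia.
rewrite vE' in DH.
have wz : w * p.2 <= z * p.1 by nia.
have : w * q.2 * p.1 <= z * p.1 * q.1 by nia.
nia.
Qed.

(** The Minkowski sum of the half plane of p with the region above the
    staircase of L is the region above the staircase of p :: L.  Given (a, b)
    above the latter, either take the whole edge p and move on in L, or stay at
    the corner of L.  Conversely, sums lie above the new staircase by
    [height_le_slope] left of the corner and by [stair_slope] right of it. *)
Lemma stair_cons p L a b : pos_pair p -> all pos_pair L ->
    all (steeper p) L ->
  (stair (p :: L) a <= b) <->
  (exists a1 a2 b1 b2, [/\ a = a1 + a2, b = b1 + b2,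
     p.1 * p.2 <= a1 * p.2 + b1 * p.1 & stair L a2 <= b2]).
Proof.
move=> pp posL pL; have /andP[p1 p2] := pp; split.
  move=> /=; case: ltnP => ap ab.
    exists a, 0, (b - \sum_(q <- L) q.2), (\sum_(q <- L) q.2).
    by split; rewrite ?addn0 -?edge_le ?stair_le_height //; lia.
  exists p.1, (a - p.1), 0, b.
  by split; rewrite ?add0n ?addn0 ?subnKC.
case=> a1 [a2] [b1] [b2] [-> -> pab Lab] /=; case: ltnP => ap.
  have := height_le_slope a2 pp posL pL.
  set D := \sum_(_ <- _) _; set H := stair _ _ in Lab * => DH.
  have Db : D <= b1 + b2.
    rewrite -(leq_pmul2r p1); nia.
  suff : edge p (a1 + a2) <= b1 + b2 - D by lia.
  rewrite edge_le // mulnBl; nia.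
case: (leqP p.1 a1) => ap1.
  rewrite addnC -addnBA // (leq_trans (stair_nonincreasing _ _ posL)) //.
  by rewrite (leq_trans Lab) ?leq_addl.
have ub : (p.1 - a1) * p.2 <= b1 * p.1 by nia.
have := stair_slope (a1 + a2 - p.1) pp posL pL ub.
by rewrite (_ : a1 + a2 - p.1 + (p.1 - a1) = a2); lia.
Qed.

Definition stair_area L := \sum_(0 <= a < \sum_(q <- L) q.1) stair L a.

Lemma stair_eq0 L a : \sum_(q <- L) q.1 <= a -> stair L a = 0.
Proof.
elim: L a => //= q L IHL a; rewrite big_cons => qa.
by rewrite ltnNge (leq_trans (leq_addr _ _) qa) /= IHL //; lia.
Qed.

Lemma stair_area_cons p L : 0 < p.1 ->
  2 * stair_area (p :: L) + gcdn p.1 p.2 =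
  2 * stair_area L + p.1 * p.2 + p.1 + p.2 + 2 * \sum_(q <- L) p.1 * q.2.
Proof.
move=> p1; rewrite /stair_area big_cons (big_cat_nat (n := p.1)) ?leq_addr //.
rewrite (eq_big_nat _ _ (F2 := fun a => edge p a + \sum_(q <- L) q.2)).
2: by move=> a /andP[_ ap]; rewrite /= ap.
rewrite big_split /= sum_nat_const_nat subn0.
set C := \sum_(q <- L) q.1.
have -> : \sum_(p.1 <= a < p.1 + C) stair (p :: L) a =
    \sum_(0 <= a < C) stair L a.
  rewrite -{1}[p.1]add0n big_addn addKn; apply: eq_bigr => a _ /=.
  by rewrite ltnNge leq_addl /= addnK.
rewrite -big_distrr /=; have := area_edge p1; lia.
Qed.

(** The area under the polygon of the Minkowski sum of p and q, in excess of the
    areas under those of p and of q. *)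
Definition mixed_area p q := minn (p.1 * q.2) (p.2 * q.1).

(** Since the steeper pair comes first, the rectangle under the edge p due to a
    later edge q has area p.1 * q.2 = mixed_area p q; counting ordered pairs
    doubles it, and p paired with itself gives the term p.1 * p.2 of
    [area_edge]. *)
Lemma stair_areaE L : all pos_pair L -> pairwise steeper L ->
  2 * stair_area L + \sum_(p <- L) gcdn p.1 p.2 =
  \sum_(p <- L) \sum_(q <- L) mixed_area p q + \sum_(p <- L) (p.1 + p.2).
Proof.
elim: L => [|p L IHL]; first by rewrite /stair_area !big_nil.
move=> /= /andP[/andP[p1 p2] posL] /andP[pL sL].
rewrite !big_cons addnA stair_area_cons //.
under [\sum_(q <- L) \sum_(r <- p :: L) _]eq_bigr do rewrite big_cons.
rewrite big_split /=.
have mixE q : q \in L -> mixed_area p q = p.1 * q.2.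
  by move=> /(allP pL); rewrite /mixed_area => /minn_idPl.
rewrite (eq_big_seq _ mixE).
have mixE' q : q \in L -> mixed_area q p = p.1 * q.2.
  by move=> qL; rewrite -(mixE q qL) /mixed_area minnC mulnC [q.1 * _]mulnC.
rewrite [X in _ = _ + (X + _) + _](eq_big_seq _ mixE').
have -> : mixed_area p p = p.1 * p.2 by rewrite /mixed_area mulnC minnn.
move: (IHL posL sL).
move: (\sum_(q <- L) gcdn _ _) (\sum_(q <- L) _ * q.2) (\sum_(q <- L) (_ + _)).
by move: (\sum_(q <- L) \sum_(_ <- _) _) => *; lia.
Qed.

Lemma exists_perm_pairwise_steeper L : all pos_pair L ->
  exists2 L', perm_eq L L' & pairwise steeper L'.
Proof.
move=> posL; exists (sort steeper L); first by rewrite perm_sym perm_sort.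
rewrite -(sorted_pairwise_in (P := pos_pair)) ?sort_sorted ?all_sort //.
  exact: steeper_total.
by move=> p q r pp pq pr; apply: steeper_trans.
Qed.

End Staircase.

(** * Products of integral closures of powers of the variables *)

Section NewtonPolygon.
Variable k : fieldType.
Local Notation R := {mpoly k[2]}.
Implicit Types (p : nat * nat) (m : 'X_{1..2}).

Definition ix : 'I_2 := inord 0.
Definition iy : 'I_2 := inord 1.

Lemma ord2P (i : 'I_2) : i = ix \/ i = iy.
Proof.
case: i => [[|[|i]] lt_i] //; [left | right];
  by apply: val_inj; rewrite /= inordK.
Qed.

Lemma eq_ix_iy : (ix == iy) = false.
Proof. by rewrite -val_eqE /= !inordK. Qed.

Definition mnm2 a b : 'X_{1..2} := (U_(ix) *+ a + U_(iy) *+ b)%MM.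

Lemma mnm2x a b : mnm2 a b ix = a.
Proof. by rewrite mnmDE !mulmnE !mnm1E eqxx eq_sym eq_ix_iy mul1n addn0. Qed.

Lemma mnm2y a b : mnm2 a b iy = b.
Proof. by rewrite mnmDE !mulmnE !mnm1E eqxx eq_ix_iy mul1n. Qed.

Lemma mnm2D a b a' b' : (mnm2 a b + mnm2 a' b')%MM = mnm2 (a + a') (b + b').
Proof. by apply/mnmP => i; rewrite !mnmDE !mulmnE; lia. Qed.

Lemma mnm2_ext m m' : m ix = m' ix -> m iy = m' iy -> m = m'.
Proof. by move=> ex ey; apply/mnmP => i; case: (ord2P i) => ->. Qed.

Lemma mnm2K m : mnm2 (m ix) (m iy) = m.
Proof. by apply: mnm2_ext; rewrite ?mnm2x ?mnm2y. Qed.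

Lemma lem2 m m' : (m <= m')%MM = (m ix <= m' ix)%N && (m iy <= m' iy)%N.
Proof.
apply/mnm_lepP/andP => [le|[lex ley] i]; first by split.
by case: (ord2P i) => ->.
Qed.

Lemma varxX a : varx k ^+ a = 'X_[mnm2 a 0].
Proof.
rewrite mpolyXn; congr 'X_[_].
by apply: mnm2_ext; rewrite !(mnm2x, mnm2y) mulmnE mnm1E ?eqxx ?eq_ix_iy ?mul1n.
Qed.

Lemma varyX b : vary k ^+ b = 'X_[mnm2 0 b].
Proof.
rewrite mpolyXn; congr 'X_[_]; apply: mnm2_ext; rewrite !(mnm2x, mnm2y) mulmnE.
  by rewrite mnm1E eq_sym eq_ix_iy.
by rewrite mnm1E eqxx mul1n.
Qed.

Definition axis_powers p m := m = mnm2 p.1 0 \/ m = mnm2 0 p.2.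

Lemma ideal_gen2_powers p :
  ideal_gen2 (varx k ^+ p.1) (vary k ^+ p.2) = mon_ideal (axis_powers p).
Proof.
rewrite varxX varyX; apply: ideal_gen_monomials => f; rewrite !inE; split.
  by move=> /orP[]/eqP->; eexists; [left|by []|right|by []].
by move=> [_ [->|->] ->]; rewrite eqxx ?orbT.
Qed.

Definition weight p m := (m ix * p.2 + m iy * p.1)%N.

Lemma weightD p a b : weight p (a + b)%MM = (weight p a + weight p b)%N.
Proof. by rewrite /weight !mnmDE; lia. Qed.

(** The exponents on or above the line through (p.1, 0) and (0, p.2). *)
Definition newton p m : Prop := (p.1 * p.2 <= weight p m)%N.

Lemma up_newton p : up (newton p) = newton p.
Proof.
apply/funext => m; apply/propext; split; last exact: up_self.
move=> [a pa am]; rewrite -[m](submK am) /newton weightD.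
by rewrite (leq_trans pa) ?leq_addl.
Qed.

Lemma axis_powers_newton p m : up (axis_powers p) m -> newton p m.
Proof.
move=> [a pa am]; rewrite -up_newton; exists a => //.
by rewrite /newton /weight; case: pa => ->; rewrite mnm2x mnm2y; lia.
Qed.

(** The lowest point of [newton p] in column a; the columns 0, ..., p.1 suffice
    to generate the ideal of [newton p]. *)
Definition newton_vertex p a := mnm2 a (edge p a).

(** The reduction number of K = (newton p) with respect to the ideal A of
    [axis_powers p] is at most 1: an exponent m of weight at least 2 p.1 p.2 either
    has abscissa at least p.1, and m - (p.1, 0) still has weight at least
    p.1 * p.2, or it has ordinate at least p.2, and m - (0, p.2) has.  In both
    cases the difference is above a vertex. *)
Lemma newton_mul_generators p (f : R) : (0 < p.1)%N ->
  weight_ge (weight p) (2 * (p.1 * p.2)) f ->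
  exists u : 'I_p.1.+1 -> R,
    (forall j, u j \in mon_ideal (axis_powers p)) /\
    f = \sum_j u j * 'X_[newton_vertex p j].
Proof.
pose generated (f : R) := exists u : 'I_p.1.+1 -> R,
  (forall j, u j \in mon_ideal (axis_powers p)) /\
  f = \sum_j u j * 'X_[newton_vertex p j].
move=> p0 fp; rewrite -/(generated f) [f]mpolyE big_seq.
have [A0 AD] := @mon_ideal_submod _ k (axis_powers p).
apply: (big_ind generated).
- by exists (fun=> 0); split=> //; rewrite big1 // => j _; rewrite mul0r.
- move=> _ _ [u [uA ->]] [u' [uA' ->]]; exists (fun j => u j + u' j); split.
    by move=> j; rewrite -[u j]mul1r; apply: AD.
  by rewrite -big_split; apply: eq_bigr => j _; rewrite mulrDl.
move=> m /fp wm.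
suff [a [j [Aa jm]]] : exists a (j : 'I_p.1.+1),
    axis_powers p a /\ (a + newton_vertex p j <= m)%MM.
  pose g := f@_m *: 'X_[(m - newton_vertex p j)%MM].
  exists (fun i => if i == j then g else 0); split.
    move=> i; case: ifP => // _; apply/mon_idealP; apply: supportedZX.
    exists a => //; apply/mnm_lepP => l; rewrite mnmBE.
    by have /mnm_lepP/(_ l) := jm; rewrite mnmDE; lia.
  rewrite (bigD1 j) //= eqxx big1 ?addr0; last first.
    by move=> i /negbTE->; rewrite mul0r.
  by rewrite -scalerAl -mpolyXD submK // (lepm_trans _ jm) // lem_addl.
rewrite /weight in wm; case: (leqP p.1 (m ix)) => mx.
  (* All columns from p.1 on are served by the vertex (p.1, 0). *)
  have jle : (minn (m ix - p.1) p.1 < p.1.+1)%N by rewrite ltnS geq_minr.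
  exists (mnm2 p.1 0), (Ordinal jle); split; first by left.
  rewrite mnm2D lem2 !mnm2x !mnm2y /= edge_le //; apply/andP; split; first lia.
  by rewrite /minn; case: ifP => _; nia.
have jle : (m ix < p.1.+1)%N by rewrite ltnS ltnW.
exists (mnm2 0 p.2), (Ordinal jle); split; first by right.
rewrite mnm2D lem2 !mnm2x !mnm2y /= leqnn /=.
have my : (p.2 <= m iy)%N by rewrite -(leq_pmul2r p0); nia.
have : (edge p (m ix) <= m iy - p.2)%N; last by lia.
rewrite edge_le // mulnBl; have := wm; have := mulnC p.1 p.2; nia.
Qed.

Lemma newton_newton_vertex p a : (0 < p.1)%N -> newton p (newton_vertex p a).
Proof.
by move=> p0; rewrite /newton /weight mnm2x mnm2y; apply: edgeP.
Qed.

(** Upper bound by the weight, lower bound by the determinant trick for the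
    generators of [newton p]. *)
Lemma integral_closure_powers p : (0 < p.1)%N ->
  integral_closure (mon_ideal (axis_powers p)) = mon_ideal (newton p) :> {pred R}.
Proof.
move=> p0; apply: pred_eq_sub => f.
  move=> /(integral_closure_weight_ge (weightD p) (q := (p.1 * p.2)%N)) fp.
  apply/mon_idealP; rewrite up_newton; apply: fp => h /mon_idealP.
  by apply: supported_sub => m; apply: axis_powers_newton.
move=> /mon_idealP; rewrite up_newton => fp.
have fv (i : 'I_p.1.+1) :
    weight_ge (weight p) (2 * (p.1 * p.2)) (f * 'X_[newton_vertex p i]).
  rewrite mul2n -addnn; apply: (weight_geM (weightD p)) => //.
  by apply: supportedX; apply: newton_newton_vertex.
have [u uP] := boolp.choice (fun i => newton_mul_generators p0 (fv i)).
apply: (@integral_closure_det _ _ p.1.+1 (fun i => 'X_[newton_vertex p i])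
  (\matrix_(i, j) u i j)) => //.
- exists ord0; apply/eqP => /(congr1 (fun g : R => g@_(newton_vertex p 0))).
  by rewrite mcoeffX eqxx mcoeff0 => /eqP; rewrite oner_eq0.
- by move=> i j; rewrite mxE; case: (uP i).
- by move=> i; case: (uP i) => _ ->; apply: eq_bigr => j _; rewrite mxE.
Qed.

Lemma maximal_ideal_newton :
  ideal_gen2 (varx k) (vary k) = mon_ideal (newton (1, 1)%N).
Proof.
rewrite -[varx k]expr1 -[vary k]expr1 (ideal_gen2_powers (1, 1)%N).
have up11 : up (axis_powers (1, 1)%N) = newton (1, 1)%N.
  apply/funext => m; apply/propext; split; first exact: axis_powers_newton.
  rewrite /newton /weight !muln1 /= addn_gt0 => /orP[mx|my].
    by exists (mnm2 1 0); [left | rewrite lem2 mnm2x mnm2y mx].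
  by exists (mnm2 0 1); [right | rewrite lem2 mnm2x mnm2y my].
by rewrite /mon_ideal up11 up_newton.
Qed.

(** Adding the half planes of a slope-sorted list joins their edges end to
    end. *)
Lemma up_minksum_newton L m : all pos_pair L -> pairwise steeper L ->
  up (\big[@minksum 2/@minksum0 2]_(p <- L) newton p) m <->
  (stair L (m ix) <= m iy)%N.
Proof.
elim: L m => [|p L IHL] m /=.
  by move=> _ _; rewrite big_nil; split=> // _; exists 0%MM => //;
    apply/mnm_lepP => i; rewrite mnm0E.
move=> /andP[pp posL] /andP[pL sL]; rewrite big_cons.
rewrite -/(stair (p :: L) (m ix)) stair_cons //.
rewrite up_minksumP up_newton; split.
  move=> [a [b [pa Lb ->]]]; exists (a ix), (b ix), (a iy), (b iy).
  by rewrite !mnmDE; split=> //; apply/IHL.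
move=> [a1 [a2 [b1 [b2 [ma mb pab Lab]]]]].
exists (mnm2 a1 b1), (mnm2 a2 b2); rewrite mnm2D -ma -mb mnm2K; split=> //.
  by rewrite /newton /weight mnm2x mnm2y.
by apply/IHL => //; rewrite mnm2x mnm2y.
Qed.

Definition below_stair L : seq 'X_{1..2} :=
  [seq mnm2 a b | a <- iota 0 (\sum_(p <- L) p.1), b <- iota 0 (stair L a)].

Lemma size_below_stair L : size (below_stair L) = stair_area L.
Proof.
rewrite size_allpairs_dep sumnE big_map /stair_area /index_iota subn0.
by apply: eq_bigr => a _; rewrite size_iota.
Qed.

Lemma uniq_below_stair L : uniq (below_stair L).
Proof.
apply: allpairs_uniq_dep => [|a _|]; rewrite ?iota_uniq //.
move=> [a b] [a' b'] _ _ /= /[dup] /(congr1 (fun m : 'X_{1..2} => m ix)).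
rewrite !mnm2x => -> /(congr1 (fun m : 'X_{1..2} => m iy)).
by rewrite !mnm2y => ->.
Qed.

Lemma mem_below_stair L m : m \in below_stair L <-> ~ (stair L (m ix) <= m iy)%N.
Proof.
split=> [/allpairsPdep[a [b [_ + ->]]]|/negP].
  by rewrite mnm2x mnm2y mem_iota add0n /= ltnNge => /negP.
rewrite -ltnNge => lt_m; apply/allpairsPdep; exists (m ix), (m iy).
rewrite mnm2K !mem_iota !add0n /= lt_m; split=> //.
by rewrite ltnNge; apply: contraL lt_m => /stair_eq0->.
Qed.

(** The Minkowski sum does not depend on the order of L, so L can be sorted by
    slope; the resulting count is symmetric in L. *)
Theorem colength_newton (L : seq (nat * nat)) (N : submodClosed R^o) :
  all pos_pair L ->
  (N : {pred R}) = mon_ideal (\big[@minksum 2/@minksum0 2]_(p <- L) newton p) ->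
  exists l, has_length (quot_mod N) l /\
    (2 * l + \sum_(p <- L) gcdn p.1 p.2 =
     \sum_(p <- L) \sum_(q <- L) mixed_area p q + \sum_(p <- L) (p.1 + p.2))%N.
Proof.
move=> posL NE; have [L' LL' sL'] := exists_perm_pairwise_steeper posL.
have posL' : all pos_pair L' by rewrite -(perm_all _ LL').
exists (stair_area L'); split.
  rewrite -size_below_stair.
  apply: (@length_monomial_quotient _ _ _ (fun m => (stair L' (m ix) <= m iy)%N)).
  - move=> f; have -> : ((f : R^o) \in N) = (f \in (N : {pred R})) by [].
    rewrite NE (perm_big _ LL'); split=> [/mon_idealP|fL'].
      by apply: supported_sub => m; rewrite up_minksum_newton.
    by apply/mon_idealP; apply: supported_sub fL' => m; rewrite up_minksum_newton.
  - exact: mem_below_stair.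
  - exact: uniq_below_stair.
under [in RHS]eq_bigr do rewrite (perm_big _ LL').
rewrite !(perm_big _ LL') /=; exact: stair_areaE.
Qed.

End NewtonPolygon.

(** * The length as a polynomial in the two exponents *)

Lemma nat_of_rat_slope (a b c d : nat) : (0 < b)%N -> (0 < d)%N ->
  (a%:R / b%:R <= c%:R / d%:R :> rat) = (a * d <= c * b)%N.
Proof.
move=> b0 d0; rewrite ler_pdivrMr ?ltr0n // mulrAC ler_pdivlMr ?ltr0n //.
by rewrite -!natrM ler_nat.
Qed.

Section Exponents.
Variables (r : nat) (c d : 'I_r -> nat).
Local Open Scope nat_scope.

(** The list of the m copies of the pairs (c_i, d_i) and the n copies of
    (1, 1) that index the factors of I^m M^n. *)
Lemma big_pairs (T : Type) (idx : T) (op : Monoid.com_law idx)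
    (F : nat * nat -> T) m n :
  \big[op/idx]_(p <- [seq (c i, d i) | e <- enum 'I_m, i <- enum 'I_r] ++
       [seq (1, 1) | e <- enum 'I_n]) F p =
  op (\big[op/idx]_(e < m) \big[op/idx]_(i < r) F (c i, d i))
     (\big[op/idx]_(e < n) F (1, 1)).
Proof.
by rewrite big_cat big_map big_allpairs_dep !big_enum.
Qed.

Hypothesis hc : forall i, 0 < c i.
Hypothesis hdc : forall i j : 'I_r, i <= j ->
       ((d j)%:R / (c j)%:R <= (d i)%:R / (c i)%:R :> rat)%R.

Lemma slopes_decrease (i j : 'I_r) : i <= j -> d j * c i <= d i * c j.
Proof. by move=> /hdc; rewrite nat_of_rat_slope. Qed.

(** For i <= j the slopes decrease, so the minimum of c_i d_j and d_i c_j is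
    the former. *)
Lemma sum_mixed_area :
  \sum_(i < r) \sum_(j < r) mixed_area (c i, d i) (c j, d j) =
  \sum_(i < r) c i * d i + 2 * \sum_(i < r) \sum_(j < r | i < j) c i * d j.
Proof.
have mixE (i j : 'I_r) : i <= j -> mixed_area (c i, d i) (c j, d j) = c i * d j.
  by move=> /slopes_decrease dc; apply/minn_idPl; rewrite /= mulnC.
have split_i (i : 'I_r) : \sum_(j < r) mixed_area (c i, d i) (c j, d j) =
    c i * d i + (\sum_(j < r | i < j) c i * d j + \sum_(j < r | j < i) c j * d i).
  rewrite (bigD1 i) //= mixE //; congr (_ + _).
  rewrite (bigID (fun j : 'I_r => i < j)) /=; congr (_ + _).
    apply: eq_big => [j|j /andP[_ ij]]; last by rewrite mixE // ltnW.
    by rewrite -val_eqE /=; case: ltngtP.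
  apply: eq_big => [j|j /andP[_ ji]]; first by rewrite -val_eqE /=; case: ltngtP.
  by rewrite -mixE 1?leqNgt // /mixed_area minnC /= mulnC [d j * _]mulnC.
rewrite (eq_bigr _ (fun i _ => split_i i)) !big_split /= mul2n -addnn.
congr (_ + (_ + _)).
by rewrite (exchange_big_dep xpredT).
Qed.

(** Slopes decrease, so i < s means that the slope of index i is at least 1,
    that is min (c_i, d_i) = c_i. *)
Lemma sum_min_legs (s : nat) :
    s = \max_(i < r | (1 <= (d i)%:R / (c i)%:R :> rat)%R) i.+1 ->
  \sum_(i < r) mixed_area (c i, d i) (1, 1) =
  \sum_(i < r | i < s) c i + \sum_(i < r | s <= i) d i.
Proof.
move=> sE; rewrite (bigID (fun i : 'I_r => i < s)) /=.
have steep (i : 'I_r) : (1 <= (d i)%:R / (c i)%:R :> rat)%R = (c i <= d i).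
  rewrite -[1%R]divr1 -[(1 / 1)%R]/(1%:R / 1%:R)%R nat_of_rat_slope //.
  by rewrite mul1n muln1.
have lt_s (i : 'I_r) : (i < s) = (c i <= d i).
  apply/idP/idP; last by rewrite -steep sE => di; apply: leq_bigmax_cond di.
  rewrite ltnNge; apply: contraNT; rewrite -ltnNge sE => dci.
  apply/bigmax_leqP => j; rewrite steep => cdj; rewrite ltnNge.
  apply/negP => /slopes_decrease; apply/negP; rewrite -ltnNge.
  by have := hc j; nia.
congr (_ + _).
  by apply: eq_bigr => i; rewrite lt_s /mixed_area /= !muln1 => /minn_idPl.
apply: eq_big => [i|i]; first by rewrite -leqNgt.
by rewrite lt_s /mixed_area /= !muln1 -ltnNge => /ltnW /minn_idPr.
Qed.

End Exponents.

Theorem theorem3p4 (k : fieldType) (r : nat) (c d : 'I_r -> nat)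
    (hr : (0 < r)%N)
    (hc : forall i, (0 < c i)%N) (hd : forall i, (0 < d i)%N)
    (hdc : forall i j : 'I_r, (i <= j)%N ->
       (d j)%:R / (c j)%:R <= (d i)%:R / (c i)%:R :> rat) :
  let M : {pred {mpoly k[2]}} := ideal_gen2 (varx k) (vary k) in
  let J (i : 'I_r) : {pred {mpoly k[2]}} :=
    integral_closure (ideal_gen2 (varx k ^+ c i) (vary k ^+ d i)) in
  let I : {pred {mpoly k[2]}} :=
    \big[@ideal_mul {mpoly k[2]}/@ideal_unit {mpoly k[2]}]_(i < r) J i in
  (* the largest 1-based index i with d_i / c_i >= 1, and 0 if there is none *)
  let s : nat :=
    (\max_(i < r | (1 <= (d i)%:R / (c i)%:R :> rat)%R) i.+1)%N in
  forall m n : nat,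
  exists l : nat,
    has_length (quot_mod (ideal_mul (ideal_exp I m) (ideal_exp M n))) l /\
    l%:R =
      (\sum_(i < r) (c i)%:R * (d i)%:R / 2
       + \sum_(i < r) \sum_(j < r | (i < j)%N) (c i)%:R * (d j)%:R) * m%:R ^+ 2
      + n%:R ^+ 2 / 2
      + (\sum_(i < r | (i < s)%N) (c i)%:R
         + \sum_(j < r | (s <= j)%N) (d j)%:R) * m%:R * n%:R
      + 2^-1 * (\sum_(i < r)
           ((c i)%:R + (d i)%:R - (gcdn (c i) (d i))%:R)) * m%:R
      + n%:R / 2 :> rat.
Proof.
move=> M J I s m n.
pose L := [seq (c i, d i) | e <- enum 'I_m, i <- enum 'I_r] ++
  [seq (1, 1)%N | e <- enum 'I_n].
have posL : all pos_pair L.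
  rewrite all_cat all_map; apply/andP; split; last by apply/allP.
  by apply/allP => p /allpairsP[[e i] /= [_ _ ->]]; rewrite /pos_pair hc hd.
have JE i : J i = mon_ideal (newton (c i, d i)).
  by rewrite /J (ideal_gen2_powers k (c i, d i)) integral_closure_powers ?hc.
have IE :
    I = mon_ideal (\big[@minksum 2/@minksum0 2]_(i < r) newton (c i, d i)).
  by rewrite /I (eq_bigr _ (fun i _ => JE i)) big_mon_ideal.
have prodE : ideal_mul (ideal_exp I m) (ideal_exp M n) =
    mon_ideal (\big[@minksum 2/@minksum0 2]_(p <- L) newton p).
  by rewrite IE /M maximal_ideal_newton !ideal_exp_mon mon_idealM big_pairs.
have [l [l_length lE]] := colength_newton posL prodE.
exists l; split=> //.
have sumL (g : nat * nat -> nat) :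
    (\sum_(p <- L) g p = m * \sum_(i < r) g (c i, d i) + n * g (1, 1))%N.
  by rewrite big_pairs !sum_nat_const !card_ord.
set S1 := (\sum_(i < r) c i * d i)%N.
set S2 := (\sum_(i < r) \sum_(j < r | i < j) c i * d j)%N.
set T := (\sum_(i < r | i < s) c i + \sum_(j < r | s <= j) d j)%N.
set G := (\sum_(i < r) gcdn (c i) (d i))%N.
set D := (\sum_(i < r) (c i + d i))%N.
have lE' : (2 * l + (m * G + n) =
    m * (m * (S1 + 2 * S2) + n * T) + n * (m * T + n) + (m * D + 2 * n))%N.
  have sym i : mixed_area (1, 1)%N (c i, d i) = mixed_area (c i, d i) (1, 1)%N.
    by rewrite /mixed_area minnC mulnC [(1 * _)%N]mulnC.
  move: lE; rewrite (sumL (fun p => gcdn p.1 p.2)) (sumL (fun p => p.1 + p.2)%N).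
  rewrite sumL /= sumL (eq_bigr _ (fun i _ => sumL (mixed_area (c i, d i)))).
  rewrite big_split /= -!big_distrr /= (sum_mixed_area hc hdc).
  rewrite (eq_bigr _ (fun i _ => sym i)) (sum_min_legs hc hdc (erefl s)).
  rewrite -/G -/D -/T.
  by rewrite /mixed_area /= gcd1n !muln1 [(n * 2)%N]mulnC.
have sum1 : \sum_(i < r) (c i)%:R * (d i)%:R / 2 = S1%:R / 2 :> rat.
  by rewrite natr_sum mulr_suml; apply: eq_bigr => i _; rewrite natrM.
have sum2 :
    \sum_(i < r) \sum_(j < r | (i < j)%N) (c i)%:R * (d j)%:R = S2%:R :> rat.
  rewrite natr_sum; apply: eq_bigr => i _; rewrite natr_sum.
  by apply: eq_bigr => j _; rewrite natrM.
have sum3 :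
    \sum_(i < r | (i < s)%N) (c i)%:R + \sum_(j < r | (s <= j)%N) (d j)%:R =
    T%:R :> rat by rewrite natrD !natr_sum.
have sum4 : \sum_(i < r) ((c i)%:R + (d i)%:R - (gcdn (c i) (d i))%:R)
    = D%:R - G%:R :> rat.
  by rewrite !natr_sum -sumrB; apply: eq_bigr => i _; rewrite natrD.
rewrite {}sum1 {}sum2 {}sum3 {}sum4; clearbody S1 S2 T G D.
have := congr1 (fun x : nat => x%:R : rat) lE'.
rewrite ![(2 * _)%N]mulnC !(natrD, natrM) => lQ.
have -> : l%:R = (l%:R * 2) / 2 :> rat by field.
have -> : l%:R * 2 = m%:R * (m%:R * (S1%:R + S2%:R * 2) + n%:R * T%:R)
   + n%:R * (m%:R * T%:R + n%:R) + (m%:R * D%:R + n%:R * 2)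
   - (m%:R * G%:R + n%:R) :> rat by rewrite -lQ addrK.
by field.
Qed.
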